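(* There is an absolute constant $c>0$ such that the following holds. Let $d\ge4$ be an integer, $p\in\big(1+\tfrac{1}{\log d+1},\,2\big)$, $q=\tfrac p{p-1}$, and $\sigma\ge \tfrac{1}{d^{1/p}}$. Then $$\sup_{\theta^\star\in\mathsf B^d_p}\mathbf E_{Y\sim\mathsf N(\theta^\star,\sigma^2I_d)}\big\|\Pi_{\mathsf B^d_p}(Y)-\theta^\star\big\|_2^2\;\ge\; c\,\min\{1,\ \sigma d^{1/q}\}.$$
   Context: $\mathsf{B}^d_p=\{x\in\mathbf{R}^d:\|x\|_p\le 1\}$ with $\|x\|_p=(\sum_i|x_i|^p)^{1/p}$; $\Pi_{\mathsf B^d_p}$ is the Euclidean projection onto $\mathsf B^d_p$ (the maximum likelihood estimator); $\log$ is the natural logarithm. *)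

(* Defs.v *)
From HB Require Import structures.
From mathcomp Require Import all_boot all_order all_algebra.
From mathcomp Require Import all_classical all_reals all_analysis.

Set Implicit Arguments.
Unset Strict Implicit.
Unset Printing Implicit Defensive.

Import Order.TTheory GRing.Theory Num.Theory.

Local Open Scope classical_set_scope.
Local Open Scope ring_scope.

Section lp_geometry.
Context {R : realType} {d : nat}.
Implicit Types (p : R) (x y : 'rV[R]_d).

Definition lp_norm p x : R := (\sum_(i < d) `|x ord0 i| `^ p) `^ p^-1.

Definition lp_ball p : set 'rV[R]_d := [set x | lp_norm p x <= 1].

Definition is_eproj (K : set 'rV[R]_d) y : set 'rV[R]_d :=
  [set z | K z /\ forall w, K w -> lp_norm 2 (y - z) <= lp_norm 2 (y - w)].

(* For K nonempty, closed and convex, is_eproj K y is a singleton and eproj K y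
   is its element; the default value 0 is only returned when no nearest point
   exists. *)
Definition eproj (K : set 'rV[R]_d) y : 'rV[R]_d := xget 0 (is_eproj K y).

End lp_geometry.

Section product_probability.
Context {disp : measure_display} {T : measurableType disp} {R : realType}.

Definition cons_pair (n : nat) (x : T * n.-tuple T) : n.+1.-tuple T :=
  [tuple of x.1 :: x.2].

Lemma measurable_cons_pair (n : nat) :
  measurable_fun [set: T * n.-tuple T] (@cons_pair n).
Proof. exact: measurable_cons. Qed.

HB.instance Definition _ (n : nat) :=
  isMeasurableFun.Build _ _ _ _ (@cons_pair n) (@measurable_cons_pair n).

Fixpoint prod_prob (n : nat) : ('I_n -> probability T R) ->
    probability (n.-tuple T) R :=
  match n with
  | 0 => fun _ => \d_[tuple]
  | n'.+1 => fun P => distribution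
      (P ord0 \x prod_prob (fun i => P (lift ord0 i)))%E (@cons_pair n')
  end.

End product_probability.

(* The law N(theta, sigma^2 I_d); the second argument of normal_prob is the
   standard deviation.  The sample space is d.-tuple R because it carries the
   product sigma-algebra, whereas 'rV[R]_d has no measurable structure. *)
Definition normal_vec {R : realType} {d : nat} (theta : 'rV[R]_d) (sigma : R) :
    probability (d.-tuple (measurableTypeR R)) R :=
  prod_prob (fun i => normal_prob (theta ord0 i) sigma).

Definition rv_of_tuple {R : realType} {d : nat} (y : d.-tuple R) : 'rV[R]_d :=
  \row_(i < d) tnth y i.

(* Main.v *)
Require Import Defs.
From HB Require Import structures.
From mathcomp Require Import all_boot all_order all_algebra.
From mathcomp Require Import all_classical all_reals all_analysis.
From mathcomp Require Import measurable_realfun ring lra.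

(* Write S = sigma d^(1/q), s = min 1 S, K for the unit lp-ball and xi for the
   noise.  With k as large as possible subject to k <= d and k^(1-2/p) >= s, let
   theta be k spikes of height k^(-1/p): it lies on the sphere of K and
   s <= |theta|^2 <= 2 s.  One of the parameters 0, theta, -theta has risk of
   order s.

   Let u be the projection of xi / 2.  Comparing the maxima over K of
   <xi, w> - |w|^2 / 2 and <xi, w> - |w|^2, either the projection of xi has
   squared norm at least s, which makes 0 a bad parameter, or |u|^2 <= s.  In the
   second case suppose that z, the projection of theta + xi, were much closer to
   theta than sqrt s.  Then z keeps almost all its lp-mass on the spikes, so its
   part off the spikes is eps v with v in K, and the obtuse angle inequality at u
   gives <xi, eps v> <= eps <xi, u> + o(s).  The obtuse angle inequality at z,
   tested against u, gives <xi, u> <= <xi, z> + o(s), and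
   <xi, z> <= <xi, theta> + eps <xi, u> + o(S), which is impossible when
   <xi, theta> <= 0, since <xi, u> is at least of order S for typical noise.
   The sign condition holds for theta or for -theta.

   The three laws are translates of one another, so these events concern a single
   noise vector and one of them has probability at least 1/6. *)

Set Implicit Arguments.
Unset Strict Implicit.
Unset Printing Implicit Defensive.

Import Order.TTheory GRing.Theory Num.Theory.
Import numFieldNormedType.Exports.

Local Open Scope classical_set_scope.
Local Open Scope ring_scope.

(** * Projection onto the lp ball *)

Section dot_product.
Context {R : realType} {d : nat}.
Implicit Types (x y z : 'rV[R]_d) (a : R).

Definition dot x y : R := \sum_(i < d) x ord0 i * y ord0 i.

Definition sqnorm x : R := dot x x.

Lemma dotC x y : dot x y = dot y x.
Proof. by apply: eq_bigr => i _; rewrite mulrC. Qed.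

Lemma dotDl x y z : dot (x + y) z = dot x z + dot y z.
Proof. by rewrite /dot -big_split; apply: eq_bigr => i _; rewrite mxE mulrDl. Qed.

Lemma dotZl a x y : dot (a *: x) y = a * dot x y.
Proof. by rewrite /dot mulr_sumr; apply: eq_bigr => i _; rewrite mxE mulrA. Qed.

Lemma dotNl x y : dot (- x) y = - dot x y.
Proof. by rewrite -scaleN1r dotZl mulN1r. Qed.

Lemma dotBl x y z : dot (x - y) z = dot x z - dot y z.
Proof. by rewrite dotDl dotNl. Qed.

Lemma dotDr x y z : dot z (x + y) = dot z x + dot z y.
Proof. by rewrite dotC dotDl 2!(dotC z). Qed.

Lemma dotBr x y z : dot z (x - y) = dot z x - dot z y.
Proof. by rewrite dotC dotBl 2!(dotC z). Qed.

Lemma dotZr a x y : dot x (a *: y) = a * dot x y.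
Proof. by rewrite dotC dotZl dotC. Qed.

Lemma sqnorm_ge0 x : 0 <= sqnorm x.
Proof. by apply: sumr_ge0 => i _; rewrite -expr2 sqr_ge0. Qed.

Lemma sqnorm_le0 x : sqnorm x <= 0 -> x = 0.
Proof.
move=> x0; apply/rowP => i; rewrite mxE; apply/eqP.
have : sqnorm x == 0 by rewrite eq_le x0 sqnorm_ge0.
have sq0 (j : 'I_d) : true -> 0 <= x ord0 j * x ord0 j by rewrite -expr2 sqr_ge0.
rewrite /sqnorm /dot psumr_eq0// => /allP/(_ i).
by rewrite mem_index_enum -expr2 sqrf_eq0 => /(_ isT).
Qed.

Lemma sqnormN x : sqnorm (- x) = sqnorm x.
Proof. by rewrite /sqnorm dotNl dotC dotNl opprK. Qed.

Lemma dot_le (A B : R) x y : 0 <= A -> 0 <= B ->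
  sqnorm x <= A ^+ 2 -> sqnorm y <= B ^+ 2 -> dot x y <= A * B.
Proof.
rewrite le_eqVlt => /predU1P[<- _|A0].
  by rewrite expr0n => /sqnorm_le0 ->; rewrite -(scale0r x) dotZl !mul0r.
rewrite le_eqVlt => /predU1P[<- _|B0 xA yB].
  by rewrite expr0n => /sqnorm_le0 ->; rewrite -(scale0r y) dotZr mulr0 mul0r.
have := sqnorm_ge0 (B *: x - A *: y).
rewrite /sqnorm !(dotBl, dotBr, dotZl, dotZr) (dotC y x) -/(sqnorm x) -/(sqnorm y).
have : B ^+ 2 * sqnorm x <= B ^+ 2 * A ^+ 2 by rewrite ler_wpM2l// sqr_ge0.
have : A ^+ 2 * sqnorm y <= A ^+ 2 * B ^+ 2 by rewrite ler_wpM2l// sqr_ge0.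
move=> yAB xAB H; rewrite -(ler_pM2l (mulr_gt0 A0 B0)); nra.
Qed.

Lemma sqnormBZ (t : R) x y :
  sqnorm (x - t *: y) = sqnorm x - 2 * t * dot x y + t ^+ 2 * sqnorm y.
Proof. by rewrite /sqnorm !(dotBl, dotBr, dotZl, dotZr) (dotC y x); ring. Qed.

Lemma lp_norm2_sqr x : lp_norm 2 x ^+ 2 = sqnorm x.
Proof.
have s0 : 0 <= \sum_(i < d) `|x ord0 i| `^ 2.
  by apply: sumr_ge0 => i _; exact: powR_ge0.
rewrite /lp_norm powR12_sqrt// sqr_sqrtr//.
by apply: eq_bigr => i _; rewrite powR_mulrn// real_normK ?num_real// expr2.
Qed.

Lemma lp_norm2_le x y : (lp_norm 2 x <= lp_norm 2 y) = (sqnorm x <= sqnorm y).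
Proof. by rewrite -!lp_norm2_sqr ler_pXn2r// nnegrE powR_ge0. Qed.

End dot_product.

Section lp_ball_theory.
Context {R : realType} {d : nat} {p : R}.
Hypothesis p1 : 1 <= p.
Implicit Types (x y z w : 'rV[R]_d).

Let p0 : 0 < p. Proof. exact: lt_le_trans p1. Qed.

Lemma in_lp_ball x : lp_ball p x <-> \sum_(i < d) `|x ord0 i| `^ p <= 1.
Proof.
have s0 : 0 <= \sum_(i < d) `|x ord0 i| `^ p.
  by apply: sumr_ge0 => i _; exact: powR_ge0.
rewrite /lp_ball /= /lp_norm; split => s1.
  have := ge0_ler_powR (ltW p0) _ _ s1.
  rewrite !nnegrE powR_ge0 ler01 => /(_ isT isT).
  by rewrite -powRrM mulVf ?gt_eqF// powRr1// powR1.
have := @ge0_ler_powR _ p^-1 _ _ _ _ _ s1.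
by rewrite !nnegrE invr_ge0 (ltW p0) s0 ler01 powR1; exact.
Qed.

Lemma lp_ball_le x y : (forall i, `|x ord0 i| <= `|y ord0 i|) ->
  lp_ball p y -> lp_ball p x.
Proof.
move=> xy /in_lp_ball y1; apply/in_lp_ball; apply: le_trans y1.
by apply: ler_sum => i _; rewrite ge0_ler_powR ?nnegrE// ltW.
Qed.

Lemma lp_ball0 : lp_ball p (0 : 'rV[R]_d).
Proof.
apply/in_lp_ball; rewrite big1// => i _.
by rewrite mxE normr0 powR0// gt_eqF.
Qed.

Lemma lp_ball_segment x y (t : R) : 0 <= t <= 1 -> lp_ball p x -> lp_ball p y ->
  lp_ball p (x + t *: (y - x)).
Proof.
move=> /andP[t0 t1] /in_lp_ball x1 /in_lp_ball y1; apply/in_lp_ball.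
apply: (@le_trans _ _
    ((1 - t) * \sum_i `|x ord0 i| `^ p + t * \sum_i `|y ord0 i| `^ p)); last first.
  move: x1 y1; set X := \sum_i _; set Y := \sum_i _ => x1 y1; nra.
rewrite !mulr_sumr -big_split /=; apply: ler_sum => i _; rewrite !mxE.
have -> : x ord0 i + t * (y ord0 i - x ord0 i) =
    (1 - t) * x ord0 i + t * y ord0 i by ring.
have t01 : (0 : R) <= 1 - t <= 1 by rewrite subr_ge0 t1 gerBl t0.
have /andP[u0 u1] := t01.
apply: (@le_trans _ _ (((1 - t) * `|x ord0 i| + t * `|y ord0 i|) `^ p)).
  rewrite ge0_ler_powR ?nnegrE ?addr_ge0 ?mulr_ge0 ?(ltW p0)//.
  by rewrite (le_trans (ler_normD _ _))// !normrM (ger0_norm u0) (ger0_norm t0).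
have := @convex_powR R p p1 (Itv01 u0 u1) `|x ord0 i| `|y ord0 i|.
rewrite !inE /= !in_itv /= !andbT => /(_ (normr_ge0 _) (normr_ge0 _)).
have cE (u v : R^o) : conv (Itv01 u0 u1) u v = (1 - t) * u + t * v.
  by rewrite convRE /= /unstable.onem subKr.
by rewrite cE [X in X `^ _ <= _ -> _]cE.
Qed.

Lemma continuous_normr_powR : continuous (fun t : R => `|t| `^ p).
Proof.
move=> t; have [->|t0] := eqVneq t 0.
  rewrite /continuous_at normr0 powR0 ?gt_eqF//; apply/cvgrPdist_le => e e0.
  near=> s.
  have s1 : `|s| <= 1 by near: s; exact: (@nbhs0_le _ R^o).
  have se : `|s| <= e by near: s; exact: (@nbhs0_le _ R^o).
  rewrite sub0r normrN ger0_norm ?powR_ge0//; apply: le_trans se.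
  have [->|s0] := eqVneq s 0; first by rewrite normr0 powR0// gt_eqF.
  by rewrite ge1r_powR// normr_gt0 s0 s1.
apply: (@continuous_comp _ _ _ (fun s : R => `|s|) (fun s => s `^ p)).
  exact: norm_continuous.
apply: differentiable_continuous; apply/derivable1_diffP.
by apply: derivable_powR; rewrite in_itv /= andbT normr_gt0.
Unshelve. all: by end_near. Qed.

Lemma compact_lp_ball : compact (@lp_ball R d p).
Proof.
apply: bounded_closed_compact.
  exists 1; split; first by rewrite num_real.
  move=> M M1 x /in_lp_ball x1; rewrite /Num.norm /= mx_normrE.
  apply: bigmax_le; first by rewrite (le_trans ler01)// ltW.
  move=> [i j] _ /=; rewrite ord1; rewrite leNgt; apply/negP => Mx.
  move: x1; apply/negP; rewrite -ltNge (bigD1 j)//=.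
  have x1 : 1 < `|x ord0 j| by exact: lt_trans Mx.
  rewrite (lt_le_trans x1)// (le_trans (le1r_powR _ p1)) ?(ltW x1)//.
  by rewrite lerDl sumr_ge0// => k _; exact: powR_ge0.
rewrite (_ : lp_ball p =
    (fun x : 'rV[R]_d => \sum_i `|x ord0 i| `^ p) @^-1` [set t | t <= 1]).
  apply: (preimage_closed _ (@closed_le R 1)) => y _; move: y.
  apply: continuous_big => [|i _ x].
    exact: (@pseudometric_normed_Zmodule.add_continuous _ R^o).
  apply: (@continuous_comp _ _ _ (fun y : 'rV[R]_d => y ord0 i) (fun t => `|t| `^ p)).
    exact: coord_continuous.
  exact: continuous_normr_powR.
by apply/seteqP; split => x /= /in_lp_ball.
Qed.

Lemma continuous_sqnorm : continuous (@sqnorm R d).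
Proof.
apply: continuous_big => [|i _ x].
  exact: (@pseudometric_normed_Zmodule.add_continuous _ R^o).
by apply: (@continuousM _ _ (fun y : 'rV[R]_d => y ord0 i) (fun y => y ord0 i));
  exact: coord_continuous.
Qed.

Lemma continuous_sqdist y : continuous (fun z : 'rV[R]_d => sqnorm (y - z)).
Proof.
move=> z; apply: (@continuous_comp _ _ _ (fun z => y - z) (@sqnorm R d)).
  by apply: (@continuousB _ _ _ (fun=> y) id); [exact: cst_continuous|exact: cvg_id].
exact: continuous_sqnorm.
Qed.

Lemma eprojP y : is_eproj (lp_ball p) y (eproj (lp_ball p) y).
Proof.
have cf := continuous_subspaceT (A := lp_ball p) (@continuous_sqdist y).
have K0 : @lp_ball R d p !=set0 by exists 0; exact: lp_ball0.
have [z zK zmin] := EVT_min_rV K0 compact_lp_ball cf.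
apply: xgetPex; exists z; split; first exact: set_mem.
by move=> w Kw; rewrite lp_norm2_le; apply: zmin; exact: mem_set.
Qed.

Lemma eproj_obtuse y z w : is_eproj (lp_ball p) y z -> lp_ball p w ->
  dot (y - z) (w - z) <= 0.
Proof.
move=> [Kz zmin] Kw; set v := w - z; set u := y - z.
have H (t : R) : 0 < t <= 1 -> 2 * dot u v <= t * sqnorm v.
  move=> /andP[t0 t1].
  have : lp_ball p (z + t *: v) by apply: lp_ball_segment => //; rewrite ltW.
  move=> /zmin; rewrite lp_norm2_le opprD addrA -/u.
  rewrite sqnormBZ => h; by rewrite -(ler_pM2l t0); lra.
suff : 2 * dot u v <= 0 by lra.
apply/ler_addgt0Pr => e e0; rewrite add0r.
have v0 := sqnorm_ge0 v.
pose t := Num.min 1 (e / (1 + sqnorm v)).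
have s0 : 0 < 1 + sqnorm v by lra.
have t0 : 0 < t by rewrite lt_min ltr01 divr_gt0.
apply: le_trans (H t _) _; first by rewrite t0 ge_min lexx.
apply: (@le_trans _ _ (e / (1 + sqnorm v) * sqnorm v)).
  by rewrite ler_wpM2r// ge_min lexx orbT.
rewrite -mulrA ler_piMr ?(ltW e0)// mulrC ler_pdivrMr// mul1r; lra.
Qed.
End lp_ball_theory.

(** * Deterministic lower bound *)

Section gap_event.
Context {R : realType} {d : nat} {p : R}.
Hypothesis p1 : 1 <= p.
Implicit Types (x y z w xi : 'rV[R]_d).

Lemma eproj_max y z w : is_eproj (lp_ball p) y z -> lp_ball p w ->
  dot y w - sqnorm w / 2 <= dot y z - sqnorm z / 2.
Proof.
move=> [_ zmin] /zmin; rewrite lp_norm2_le -(scale1r z) -(scale1r w) !sqnormBZ.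
by rewrite !scale1r; lra.
Qed.

Lemma eproj_half_max xi z w : is_eproj (lp_ball p) (2^-1 *: xi) z ->
  lp_ball p w -> dot xi w - sqnorm w <= dot xi z - sqnorm z.
Proof. by move=> /eproj_max h /h; rewrite !dotZl; lra. Qed.

Definition rat_rv (w : 'rV[rat]_d) : 'rV[R]_d := map_mx ratr w.

Lemma rat_approx (a e : R) : 0 < e ->
  exists2 r : rat, `|ratr r| <= `|a| & `|a - ratr r| <= e.
Proof.
move=> e0; have [a0|a0|->] := ltgtP a 0; last first.
- by exists 0; rewrite raddf0 ?subrr ?normr0// ltW.
- have [|r] := @rat_in_itvoo R (Num.max 0 (a - e)) a.
    by rewrite gt_max a0 gtrBl.
  rewrite in_itv /= gt_max => /andP[/andP[r0 rae] ra]; exists r.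
    by rewrite !gtr0_norm// ltW.
  by rewrite ger0_norm ?subr_ge0 ?(ltW ra)//; lra.
- have [|r] := @rat_in_itvoo R a (Num.min 0 (a + e)).
    by rewrite lt_min a0 ltrDl.
  rewrite in_itv /= lt_min => /andP[ra /andP[r0 rae]]; exists r.
    by rewrite !ltr0_norm// lerN2 ltW.
  by rewrite ltr0_norm ?subr_lt0//; lra.
Qed.

Lemma rat_rv_dense xi x (e : R) : lp_ball p x -> 0 < e ->
  exists w : 'rV[rat]_d, [/\ lp_ball p (rat_rv w), dot xi x - e <= dot xi (rat_rv w) &
    sqnorm (rat_rv w) <= sqnorm x].
Proof.
move=> Kx e0; pose M := 1 + \sum_i `|xi ord0 i|.
have M0 : 0 < M by rewrite ltr_pwDl// sumr_ge0.
have eM0 : 0 < e / M by rewrite divr_gt0.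
have /choice[w wP] : forall i, exists r : rat,
    `|ratr r| <= `|x ord0 i| /\ `|x ord0 i - ratr r| <= e / M.
  by move=> i; have [r ? ?] := rat_approx (x ord0 i) eM0; exists r.
exists (\row_i w i).
have wE i : rat_rv (\row_i w i) ord0 i = ratr (w i) by rewrite !mxE.
split.
- by apply: lp_ball_le Kx => // i; rewrite wE; case: (wP i).
- rewrite lerBlDr -lerBlDl -dotBr (@le_trans _ _ (\sum_i `|xi ord0 i| * (e / M)))//.
    apply: ler_sum => i _; rewrite !mxE (le_trans (ler_norm _))// normrM.
    by rewrite ler_wpM2l//; case: (wP i).
  rewrite -mulr_suml mulrCA ler_piMr ?(ltW e0)// ler_pdivrMr// mul1r /M.
  by rewrite lerDr.
- apply: ler_sum => i _; rewrite wE -!expr2; case: (wP i) => wx _.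
  have sq (t : R) : t ^+ 2 = `|t| ^+ 2 by rewrite real_normK ?num_real.
  by rewrite sq [leRHS]sq ler_pXn2r ?nnegrE.
Qed.

(* The rational quantifiers make the event measurable; it compares the maxima
   over the ball of <xi, w> - |w|^2 / 2 and of <xi, w> - |w|^2, attained at the
   projections of xi and of xi / 2. *)
Definition gap_event (s : R) : set 'rV[R]_d := [set xi |
  exists2 w : 'rV[rat]_d, lp_ball p (rat_rv w) &
    forall v : 'rV[rat]_d, lp_ball p (rat_rv v) ->
    s / 2 < dot xi (rat_rv w) - sqnorm (rat_rv w) / 2 -
            (dot xi (rat_rv v) - sqnorm (rat_rv v))].

Lemma gap_event_sqnorm s xi z : gap_event s xi -> is_eproj (lp_ball p) xi z ->
  s <= sqnorm z.
Proof.
move=> [w Kw wP] zP; suff : s / 2 <= sqnorm z / 2 by lra.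
apply/ler_addgt0Pr => e e0.
have [v [Kv vz sv]] := rat_rv_dense xi (proj1 zP) e0.
have := wP v Kv; have := eproj_max zP Kw; lra.
Qed.

Lemma gap_eventN_sqnorm s xi z : ~ gap_event s xi ->
  is_eproj (lp_ball p) (2^-1 *: xi) z -> sqnorm z <= s.
Proof.
move=> nE zP; suff : sqnorm z / 2 <= s / 2 by lra.
apply/ler_addgt0Pr => e e0.
have [w [Kw wz sw]] := rat_rv_dense xi (proj1 zP) e0.
have [v Kv vP] : exists2 v : 'rV[rat]_d, lp_ball p (rat_rv v) &
    dot xi (rat_rv w) - sqnorm (rat_rv w) / 2 -
    (dot xi (rat_rv v) - sqnorm (rat_rv v)) <= s / 2.
  apply: contrapT => nv; apply: nE; exists w => // v Kv; rewrite ltNge.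
  by apply/negP => vs; apply: nv; exists v.
have := eproj_half_max zP Kv; lra.
Qed.

End gap_event.

Arguments gap_event {R d} p s _.

Section spike.
Context {R : realType} {d : nat} {p : R}.
Hypotheses (p1 : 1 <= p) (p2 : p <= 2).
Implicit Types (x y z w u xi : 'rV[R]_d) (A : {set 'I_d}).

Definition restr A x : 'rV[R]_d := \row_i (if i \in A then x ord0 i else 0).

Lemma restr_setC A x : restr A x + restr (~: A) x = x.
Proof.
by apply/rowP => i; rewrite !mxE inE; case: (i \in A); rewrite ?addr0 ?add0r.
Qed.

Lemma dot_restr A x y : dot x (restr A y) = dot (restr A x) y.
Proof.
by apply: eq_bigr => i _; rewrite !mxE; case: ifP; rewrite ?mulr0 ?mul0r.
Qed.

Lemma sqnorm_restr A x : sqnorm (restr A x) = \sum_(i in A) x ord0 i ^+ 2.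
Proof.
rewrite [RHS]big_mkcond; apply: eq_bigr => i _.
by rewrite mxE; case: ifP; rewrite ?mulr0 ?expr2.
Qed.

Lemma sqnorm_restr_le A x : sqnorm (restr A x) <= sqnorm x.
Proof.
apply: ler_sum => i _; rewrite mxE; case: ifP => // _.
by rewrite mulr0 -expr2 sqr_ge0.
Qed.

Definition spike A (h : R) : 'rV[R]_d := \row_i (if i \in A then h else 0).

Lemma sqnorm_spike A h : sqnorm (spike A h) = #|A|%:R * h ^+ 2.
Proof.
rewrite mulr_natl -sumr_const [RHS]big_mkcond; apply: eq_bigr => i _.
by rewrite mxE; case: ifP; rewrite ?mulr0 ?expr2.
Qed.

Lemma lp_ball_spike A h : #|A|%:R * `|h| `^ p <= 1 -> lp_ball p (spike A h).
Proof.
move=> Ah; apply/(in_lp_ball p1); apply: le_trans Ah.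
rewrite mulr_natl -sumr_const [leRHS]big_mkcond ler_sum// => i _.
rewrite mxE; case: ifP => // _; rewrite normr0 powR0// gt_eqF//.
exact: lt_le_trans p1.
Qed.

Lemma normr_powR_lb (t : R) : 1 - 2 * `|t - 1| <= `|t| `^ p.
Proof.
have [t1|t1] := leP 1 `|t|.
  apply: (@le_trans _ _ 1); first by rewrite gerBl mulr_ge0.
  by rewrite (le_trans t1)// le1r_powR.
have [->|t0] := eqVneq t 0.
  by rewrite sub0r normrN normr1 (le_trans _ (powR_ge0 _ _))//; lra.
apply: (@le_trans _ _ (`|t| ^+ 2)).
  have := ler_norm (1 - t); rewrite distrC.
  have := ler_norm (t); rewrite real_normK ?num_real//; nra.
rewrite -powR_mulrn//; apply: ger_powR => //.
by rewrite normr_gt0 t0 ltW.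
Qed.

Lemma lp_mass_off_spike A (h g : R) z : 0 < g -> h != 0 ->
  #|A|%:R * `|h| `^ p = 1 -> lp_ball p z ->
  sqnorm (z - spike A h) <= g ^+ 2 * (#|A|%:R * h ^+ 2) ->
  \sum_(i in ~: A) `|z ord0 i| `^ p <= 2 * g.
Proof.
move=> g0 h0 Ah /(in_lp_ball p1); rewrite (bigID (mem A)) /= => zK zh.
have -> : \sum_(i in ~: A) `|z ord0 i| `^ p = \sum_(i | i \notin A) `|z ord0 i| `^ p.
  by apply: eq_bigl => i; rewrite inE.
suff : 1 - 2 * g <= \sum_(i in A) `|z ord0 i| `^ p by lra.
have sA : sqnorm (restr A (z - spike A h)) <= g ^+ 2 * (#|A|%:R * h ^+ 2).
  exact: le_trans (sqnorm_restr_le _ _) zh.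
pose a i := z ord0 i / h - 1.
have sa : \sum_(i in A) a i ^+ 2 <= g ^+ 2 * #|A|%:R.
  have h2 : 0 < h ^+ 2 by rewrite exprn_even_gt0.
  rewrite -(ler_pM2r h2) mulr_suml -mulrA; apply: le_trans sA.
  rewrite sqnorm_restr; apply: ler_sum => i iA.
  by rewrite -exprMn /a mulrBl mul1r divfK// !mxE iA.
apply: (@le_trans _ _ (\sum_(i in A)
    `|h| `^ p * (1 - (a i ^+ 2 / g + g)))); last first.
  apply: ler_sum => i iA.
  have -> : `|z ord0 i| = `|h| * `|z ord0 i / h| by rewrite -normrM mulrC divfK.
  rewrite powRM// ler_wpM2l ?powR_ge0//.
  apply: le_trans (normr_powR_lb _); rewrite -/(a i) lerB//.
  have : 0 <= (`|a i| - g) ^+ 2 / g by rewrite divr_ge0 ?sqr_ge0// ltW.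
  have -> : (`|a i| - g) ^+ 2 / g = a i ^+ 2 / g - 2 * `|a i| + g.
    by rewrite sqrrB real_normK ?num_real//; field; rewrite gt_eqF.
  by lra.
rewrite -mulr_sumr sumrB big_split /= !sumr_const -mulr_suml -[g *+ _]mulr_natr.
have : (\sum_(i in A) a i ^+ 2) / g <= g * #|A|%:R.
  by rewrite ler_pdivrMr// (le_trans sa)// expr2 mulrAC.
have := powR_ge0 `|h| p; nra.
Qed.

Lemma spike_risk A (h s S B : R) xi z u :
  0 < s <= S -> h != 0 -> #|A|%:R * `|h| `^ p = 1 ->
  s <= #|A|%:R * h ^+ 2 <= 2 * s ->
  0 <= B -> B ^+ 2 * s <= 24 * S ^+ 2 ->
  is_eproj (lp_ball p) (spike A h + xi) z ->
  is_eproj (lp_ball p) (2^-1 *: xi) u -> sqnorm u <= s ->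
  S / 1024 <= dot xi u -> dot xi (spike A h) <= 0 ->
  \sum_(i in A) xi ord0 i ^+ 2 <= B ^+ 2 ->
  (128^-1) ^+ 4 / 4 * s <= sqnorm (z - spike A h).
Proof.
move=> /andP[s0 sS] h0 Ah /andP[sA As] B0 Bs zP uP us SX xiA BA.
set th := spike A h in xiA zP *; rewrite leNgt; apply/negP.
pose e : R := 128^-1; pose g := e ^+ 2 / 2; pose r := Num.sqrt s.
rewrite -/e (_ : e ^+ 4 / 4 = g ^+ 2); last by rewrite /g; field.
have e0 : 0 < e by rewrite invr_gt0.
have g0 : 0 < g by rewrite divr_gt0// exprn_gt0.
have r2 : r ^+ 2 = s by rewrite sqr_sqrtr// ltW.
have r0 : 0 < r by rewrite sqrtr_gt0.
have [w zE] : exists w, z = th + w by exists (z - th); rewrite addrC subrK.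
have zw : z - th = w by rewrite zE addrC addKr.
rewrite zw => ws.
have {}ws : sqnorm w <= (g * r) ^+ 2 by rewrite exprMn r2 ltW.
have gr0 : 0 <= g * r by rewrite mulr_ge0// ltW.
have Kz := proj1 zP; have Ku := proj1 uP.
set X := dot xi u in SX *.
have X1 : X <= dot xi z + dot w u + dot w (- th).
  have := eproj_obtuse p1 zP Ku.
  have -> : th + xi - z = xi - w by rewrite zE; apply/rowP => i; rewrite !mxE; ring.
  have := sqnorm_ge0 w; rewrite /sqnorm.
  rewrite dotBl !dotBr -/X (dotC w (- th)) dotNl (dotC th).
  have -> : dot w z = dot w th + dot w w by rewrite {1}zE dotDr.
  by lra.
have wu : dot w u <= g * r * r.
  by apply: dot_le => //; [exact: ltW|rewrite r2].
have wth : dot w (- th) <= g * r * (2 * r).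
  apply: dot_le => //; first by rewrite mulr_ge0// ltW.
  rewrite sqnormN sqnorm_spike exprMn r2; move: As; lra.
have zR : restr (~: A) z = restr (~: A) w.
  by apply/rowP => i; rewrite zE !mxE inE; case: (i \in A); rewrite ?add0r.
have X2 : dot xi z <= dot (restr A xi) w + dot xi (restr (~: A) z).
  rewrite -dot_restr zR {1}zE dotDr -{1}(restr_setC A w) dotDr; lra.
have xw : dot (restr A xi) w <= B * (g * r).
  by apply: dot_le => //; rewrite sqnorm_restr.
have Br : B * r <= 5 * S.
  have S0 : 0 <= 5 * S by rewrite mulr_ge0// ltW// (lt_le_trans s0).
  rewrite -(@ler_pXn2r _ 2)// ?nnegrE ?mulr_ge0 ?(ltW r0)//.
  by rewrite !exprMn r2; have := sqr_ge0 S; lra.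
pose v := e^-1 *: restr (~: A) z.
have Kv : lp_ball p v.
  apply/(in_lp_ball p1).
  apply: (@le_trans _ _ (\sum_(i in ~: A) e ^- 2 * `|z ord0 i| `^ p)).
    rewrite [leRHS]big_mkcond; apply: ler_sum => i _; rewrite !mxE.
    have p0 : 0 < p by exact: lt_le_trans p1.
    case: ifP => _; last by rewrite mulr0 normr0 powR0// gt_eqF.
    rewrite normrM powRM// ler_wpM2r ?powR_ge0// gtr0_norm ?invr_gt0//.
    by rewrite -exprVn -powR_mulrn ?invr_ge0 ?(ltW e0)// ler_powR// invrK; lra.
  rewrite -mulr_sumr mulrC ler_pdivrMr ?exprn_gt0// mul1r.
  apply: le_trans (lp_mass_off_spike g0 h0 Ah Kz _) _; last by rewrite /g; lra.
  by rewrite -/th zw; apply: le_trans ws _; rewrite exprMn r2 ler_wpM2l// sqr_ge0.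
have X3 : dot xi (restr (~: A) z) <= e * X + 2 * dot u (restr (~: A) z).
  have := eproj_obtuse p1 uP Kv; rewrite !(dotBl, dotBr, dotZl) -/X.
  have -> : restr (~: A) z = e *: v by rewrite /v scalerA divff ?gt_eqF// scale1r.
  rewrite !dotZr -/(sqnorm u); have := sqnorm_ge0 u => u0 h1.
  by have := mulr_ge0 (ltW e0) u0; have := ler_wpM2l (ltW e0) h1; lra.
have uz : dot u (restr (~: A) z) <= r * (g * r).
  apply: dot_le => //; [exact: ltW|by rewrite r2|].
  by rewrite zR; exact: le_trans (sqnorm_restr_le _ _) ws.
have gS : g * s <= g * S by rewrite ler_pM2l.
have gBr : g * (B * r) <= g * (5 * S) by rewrite ler_pM2l.
have rr : r * r = s by rewrite -expr2.
have S0 : 0 < S by exact: lt_le_trans sS.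
have : X <= e * X + 10 * g * S.
  have e1 : g * r * r = g * s by rewrite -rr mulrA.
  have e2 : g * r * (2 * r) = 2 * (g * s) by rewrite -rr; ring.
  have e3 : r * (g * r) = g * s by rewrite -rr; ring.
  by move: wu wth xw uz; rewrite e1 e2 e3 (mulrCA B); lra.
rewrite /g /e; lra.
Qed.

End spike.

Lemma gt0_powRD (R : realType) (a x y : R) : 0 < a ->
  a `^ (x + y) = a `^ x * a `^ y.
Proof. by move=> a0; rewrite powRD// (gt_eqF a0) implybT. Qed.

Section worst_case.
Context {R : realType} {d : nat} {p : R}.
Hypotheses (p1 : 1 <= p) (p2 : p <= 2) (d0 : (0 < d)%N).
Implicit Types (xi u : 'rV[R]_d) (sigma : R).

Let p0 : 0 < p. Proof. exact: lt_le_trans p1. Qed.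

Let dR : 1 <= d%:R :> R. Proof. by rewrite ler1n. Qed.

(* Test the optimality of u against d^(-1/p) / 32 times the sign vector of xi. *)
Lemma dot_eproj_half_ge xi u sigma :
  d%:R `^ (- p^-1) <= sigma -> sigma * d%:R / 16 <= \sum_i `|xi ord0 i| ->
  is_eproj (lp_ball p) (2^-1 *: xi) u ->
  sigma * d%:R `^ (1 - p^-1) / 1024 <= dot xi u.
Proof.
move=> sd xid uP; set S := sigma * _.
have dp : 0 < d%:R :> R by exact: lt_le_trans dR.
pose a : R := d%:R `^ (- p^-1).
have a0 : 0 < a by exact: powR_gt0.
have da : d%:R `^ (1 - p^-1) = d%:R * a :> R.
  by rewrite gt0_powRD// powRr1// ltW.
have ap : d%:R * a `^ p = 1.
  by rewrite /a -powRrM mulNr mulVf ?gt_eqF// powR_inv1 ?ltW// divff ?gt_eqF.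
pose v : 'rV[R]_d := \row_i (a / 32 * Num.sg (xi ord0 i)).
have va i : `|v ord0 i| <= a / 32.
  rewrite mxE normrM normr_sg gtr0_norm ?divr_gt0//.
  by rewrite ler_piMr ?divr_ge0 ?(ltW a0)//; case: eqP.
have Kv : lp_ball p v.
  apply/(in_lp_ball p1); rewrite -ap mulr_natl.
  rewrite -[X in _ *+ X](card_ord d) -sumr_const ler_sum// => i _.
  rewrite ge0_ler_powR ?nnegrE ?(ltW p0) ?(ltW a0)//.
  by rewrite (le_trans (va i))//; lra.
have sv : sqnorm v <= d%:R * (a / 32) ^+ 2.
  rewrite mulr_natl -[X in _ *+ X](card_ord d) -sumr_const ler_sum// => i _.
  rewrite -expr2 -real_normK ?num_real// ler_pXn2r ?nnegrE//.
  by rewrite divr_ge0// ltW.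
have xv : dot xi v = a / 32 * \sum_i `|xi ord0 i|.
  rewrite mulr_sumr; apply: eq_bigr => i _.
  by rewrite mxE mulrCA normrEsg (mulrC (Num.sg _)).
have := eproj_half_max uP Kv; rewrite xv.
have : a / 32 * (sigma * d%:R / 16) <= a / 32 * \sum_i `|xi ord0 i|.
  by rewrite ler_wpM2l// divr_ge0// ltW.
have : d%:R * a * a <= d%:R * a * sigma by rewrite ler_wpM2l// mulr_ge0 ?ltW.
by have := sqnorm_ge0 u; rewrite /S da; lra.
Qed.

Lemma exists_spike_size (s : R) : s <= 1 -> d%:R `^ (1 - 2 / p) <= s ->
  exists2 k, (0 < k <= d)%N & s <= k%:R `^ (1 - 2 / p) <= 2 * s.
Proof.
move=> s1 ds; pose P k := [&& (0 < k)%N, (k <= d)%N & s <= k%:R `^ (1 - 2 / p)].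
have P1 : exists k, P k by exists 1%N; rewrite /P d0 powR1.
have Pd k : P k -> (k <= d)%N by case/and3P.
have [k /and3P[k0 kd sk] kmax] := ex_maxnP P1 Pd.
exists k; rewrite ?k0// sk /=.
have s0 : 0 < s by apply: lt_le_trans ds; rewrite powR_gt0// ltr0n.
have [kd'|kd'] := ltnP k d; last first.
  have -> : k = d by apply/eqP; rewrite eqn_leq kd.
  by rewrite (le_trans ds)// ler_peMl ?ltW//; lra.
have ks : k.+1%:R `^ (1 - 2 / p) < s.
  by rewrite ltNge; apply/negP => h; have := kmax k.+1; rewrite /P kd' h ltnn => /(_ isT).
have e0 : 0 <= 2 / p - 1 by rewrite subr_ge0 ler_pdivlMr// mul1r.
have e1 : 2 / p - 1 <= 1.
  by rewrite lerBlDr ler_pdivrMr// ler_peMr.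
rewrite -opprB powRN in ks *; set e := 2 / p - 1 in e0 e1 ks *.
have k0R : 0 < k%:R :> R by rewrite ltr0n.
have ke0 : 0 < k%:R `^ e :> R by exact: powR_gt0.
have : k.+1%:R `^ e <= 2 * k%:R `^ e :> R.
  apply: (@le_trans _ _ ((2 * k%:R) `^ e)).
    rewrite ge0_ler_powR ?nnegrE ?mulr_ge0// -natrM ler_nat mul2n -addnn.
    by rewrite -addn1 leq_add2l.
  rewrite powRM// ler_wpM2r ?powR_ge0// -[leRHS]powRr1//.
  by rewrite ler_powR// ler1n.
move: ks; rewrite invf_plt ?posrE ?powR_gt0 ?ltr0n// => ks h.
have {ks h} : s^-1 < 2 * k%:R `^ e by exact: lt_le_trans h.
rewrite -div1r ltr_pdivrMr// => /ltW h.
by rewrite powRN -div1r ler_pdivrMr// mulrAC.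
Qed.

Definition typical_noise sigma (A : {set 'I_d}) : set 'rV[R]_d := [set xi |
  sigma * d%:R / 16 <= \sum_i `|xi ord0 i| /\
  \sum_(i in A) xi ord0 i ^+ 2 <= 24 * sigma ^+ 2 * #|A|%:R].

Lemma exists_hard_spike sigma (s : R) : d%:R `^ (- p^-1) <= sigma ->
  s = Num.min 1 (sigma * d%:R `^ (1 - p^-1)) ->
  exists (A : {set 'I_d}) (h : R), [/\ (0 < #|A|)%N, 0 < h &
    forall h', `|h'| = h -> lp_ball p (spike A h') /\
    forall xi z, typical_noise sigma A xi -> ~ gap_event p s xi ->
      dot xi (spike A h') <= 0 -> is_eproj (lp_ball p) (spike A h' + xi) z ->
      (128^-1) ^+ 4 / 4 * s <= sqnorm (z - spike A h')].
Proof.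
move=> sd sE; set S := sigma * _ in sE.
have dp : 0 < d%:R :> R by exact: lt_le_trans dR.
have sigma0 : 0 < sigma by rewrite (lt_le_trans _ sd)// powR_gt0.
have S0 : 0 < S by rewrite mulr_gt0// powR_gt0.
have s0 : 0 < s by rewrite sE lt_min ltr01 S0.
have sS : s <= S by rewrite sE ge_min lexx orbT.
have s1 : s <= 1 by rewrite sE ge_min lexx.
have ds : d%:R `^ (1 - 2 / p) <= s.
  rewrite sE le_min; apply/andP; split.
    by rewrite -[leRHS](powRr0 d%:R) ler_powR// subr_le0 ler_pdivlMr// mul1r.
  have -> : 1 - 2 / p = - p^-1 + (1 - p^-1) by field; rewrite gt_eqF.
  by rewrite gt0_powRD// ler_wpM2r// powR_ge0.
have [k /andP[k0 kd] /andP[sk ks]] := exists_spike_size s1 ds.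
have k0R : 0 < k%:R :> R by rewrite ltr0n.
pose A : {set 'I_d} := [set widen_ord kd i | i : 'I_k].
have cA : #|A| = k.
  rewrite card_imset ?card_ord//.
  by move=> i j /(congr1 val) /= ij; exact: val_inj.
pose h : R := k%:R `^ (- p^-1).
have h0 : 0 < h by exact: powR_gt0.
have khp : k%:R * h `^ p = 1.
  by rewrite /h -powRrM mulNr mulVf ?gt_eqF// powR_inv1 ?ltW// divff ?gt_eqF.
have kh2 : k%:R * h ^+ 2 = k%:R `^ (1 - 2 / p).
  rewrite -powR_mulrn ?(ltW h0)// /h -powRrM -{1}(powRr1 (ltW k0R)) -gt0_powRD//.
  by congr powR; rewrite mulNr mulrC.
exists A, h; rewrite cA; split => // h' h'E; split.
  by apply: lp_ball_spike => //; rewrite cA h'E khp.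
move=> xi z [xi1 xiA] ngap xisp zP.
have uP := eprojP p1 (2^-1 *: xi).
have B0 : 0 <= 24 * sigma ^+ 2 * k%:R by rewrite !mulr_ge0 ?sqr_ge0// ltW.
apply: (@spike_risk _ _ _ p1 p2 _ _ _ S (Num.sqrt (24 * sigma ^+ 2 * k%:R)) _ _ _
  _ _ _ _ _ _ zP uP) => //.
- by rewrite s0.
- by rewrite -normr_gt0 h'E.
- by rewrite cA h'E.
- by rewrite cA -real_normK ?num_real// h'E kh2 sk ks.
- rewrite sqr_sqrtr//.
  apply: (@le_trans _ _ (24 * sigma ^+ 2 * k%:R * k%:R `^ (1 - 2 / p))).
    by rewrite ler_wpM2l.
  have -> : 24 * sigma ^+ 2 * k%:R * k%:R `^ (1 - 2 / p) =
      24 * (sigma * k%:R `^ (1 - p^-1)) ^+ 2.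
    have -> : 24 * sigma ^+ 2 * k%:R * k%:R `^ (1 - 2 / p) =
        24 * sigma ^+ 2 * (k%:R `^ 1 * k%:R `^ (1 - 2 / p)).
      by rewrite powRr1 ?(ltW k0R)// mulrA.
    rewrite -gt0_powRD// (_ : 1 + (1 - 2 / p) = (1 - p^-1) + (1 - p^-1)); last by ring.
    by rewrite gt0_powRD//; ring.
  rewrite ler_wpM2l// ler_pXn2r ?nnegrE ?mulr_ge0 ?powR_ge0 ?(ltW sigma0)//.
  rewrite ler_wpM2l ?(ltW sigma0)// ge0_ler_powR ?nnegrE// ?ler_nat//.
  by rewrite subr_ge0 invf_le1.
- exact: gap_eventN_sqnorm ngap uP.
- exact: dot_eproj_half_ge.
- by rewrite sqr_sqrtr// -cA.
Qed.

End worst_case.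

(** * Gaussian product measures *)

Section normal_prob_integral.
Context {R : realType}.
Implicit Types (m s : R).
Local Notation mu := (@lebesgue_measure R).

Lemma ge0_integral_normal_prob m s (f : measurableTypeR R -> \bar R) :
  measurable_fun [set: measurableTypeR R] f -> (forall x, 0 <= f x)%E ->
  (\int[normal_prob m s]_x f x = \int[mu]_x (f x * (normal_pdf m s x)%:E))%E.
Proof.
move=> mf f0; have dom := normal_prob_dominates m s.
rewrite -(Radon_Nikodym_SigmaFinite.change_of_variables dom)//.
have mg : measurable_fun [set: measurableTypeR R]
    (fun x : measurableTypeR R => (normal_pdf m s x)%:E).
  by apply/measurable_EFinP; exact: measurable_normal_pdf.
apply: ae_eq_integral => //.
- apply: emeasurable_funM => //; apply: measurable_int.
  exact: Radon_Nikodym_SigmaFinite.f_integrable dom.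
- exact: emeasurable_funM.
- apply: ae_eqe_mul2l; apply: integral_ae_eq => //.
    exact: Radon_Nikodym_SigmaFinite.f_integrable.
  by move=> E _ mE; rewrite -Radon_Nikodym_SigmaFinite.f_integral.
Qed.

Lemma lebesgue_measure_shift (a : R) (A : set (measurableTypeR R)) :
  measurable A -> mu ((fun x : measurableTypeR R => x + a) @^-1` A) = mu A.
Proof.
move=> mA; pose f (x : measurableTypeR R) : measurableTypeR R := x + a.
have mf : measurable_fun [set: measurableTypeR R] f by exact: measurable_funD.
apply/esym; apply: (@lebesgue_measure_unique R (pushforward mu f)) => //.
move=> _ [[x y]] _ <-.
transitivity (mu `]x - a, y - a]%classic).
  rewrite !lebesgue_measure_itv/= !lte_fin ltrD2r; case: ifP => // _.
  by rewrite -!EFinB; congr EFin; ring.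
congr (mu _); apply/seteqP; split => z /=; rewrite !in_itv/=;
  by rewrite ltrBlDr lerBrDr.
Qed.

Lemma normal_prob_shift m s (A : set (measurableTypeR R)) : s != 0 -> measurable A ->
  normal_prob m s A =
  normal_prob 0 s ((fun x : measurableTypeR R => x + m) @^-1` A).
Proof.
move=> s0 mA; rewrite /normal_prob.
pose f := (fun x : measurableTypeR R => x + m : measurableTypeR R).
have mf : measurable_fun [set: measurableTypeR R] f by exact: measurable_funD.
transitivity (\int[pushforward mu f]_(x in A) (normal_pdf m s x)%:E)%E.
  apply: eq_measure_integral => B mB _.
  exact/esym/lebesgue_measure_shift.
rewrite ge0_integral_pushforward//.
- apply: eq_integral => x _ /=.
  by rewrite !normal_pdfE// /normal_fun addrK subr0.
- by apply/measurable_funTS/measurable_EFinP; exact: measurable_normal_pdf.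
- by move=> x _; rewrite lee_fin normal_pdf_ge0.
Qed.

Lemma normal_peakM (a s : R) : 0 < a -> normal_peak (a * s) = a^-1 * normal_peak s.
Proof.
move=> a0; rewrite /normal_peak exprMn -mulrA -mulrnAr.
by rewrite sqrtrM ?sqr_ge0// sqrtr_sqr gtr0_norm// invfM.
Qed.

Lemma normal_prob_itv_le s (b : R) : 0 < s -> 0 <= b ->
  (normal_prob 0 s `[(- (b * s))%R, (b * s)%R]%classic <= b%:E)%E.
Proof.
move=> s0 b0; have bs0 : 0 <= b * s by rewrite mulr_ge0// ltW.
have sN0 : s != 0 by rewrite gt_eqF.
have peak_le : normal_peak s <= (2 * s)^-1.
  rewrite /normal_peak lef_pV2 ?posrE ?mulr_gt0//; last first.
    by rewrite sqrtr_gt0 mulrn_wgt0// mulr_gt0 ?exprn_gt0// pi_gt0.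
  have -> : 2 * s = Num.sqrt ((2 * s) ^+ 2).
    by rewrite sqrtr_sqr gtr0_norm// mulr_gt0.
  apply: ler_wsqrtr.
  have := @pi_ge2 R; have := exprn_gt0 2 s0; rewrite -mulr_natr; nra.
rewrite /normal_prob.
apply: (@le_trans _ _
    (\int[mu]_(x in `[(- (b * s))%R, (b * s)%R]%classic) ((2 * s)^-1)%:E)%E).
  apply: ge0_le_integral => //.
  - by move=> x _; rewrite lee_fin normal_pdf_ge0.
  - by apply/measurable_funTS/measurable_EFinP; exact: measurable_normal_pdf.
  - by move=> x _; rewrite lee_fin (le_trans (normal_pdf_ub _ _ _)).
rewrite integral_cst//= lebesgue_measure_itv/= lte_fin.
case: ifP => _; last by rewrite mule0 lee_fin.
by rewrite -EFinB -EFinM lee_fin opprK ler_pdivrMl ?mulr_gt0//; lra.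
Qed.

Lemma normal_prob_sqr_le s : 0 < s ->
  (\int[normal_prob 0 s]_x (x ^+ 2)%:E <= (6 * s ^+ 2)%:E)%E.
Proof.
move=> s0; have sN0 : s != 0 by rewrite gt_eqF.
have s2N0 : 2 * s != 0 by rewrite mulf_neq0.
have mpdf t : measurable_fun [set: measurableTypeR R]
    (fun x : measurableTypeR R => (normal_pdf 0 t x)%:E).
  by apply/measurable_EFinP; exact: measurable_normal_pdf.
have msqr : measurable_fun [set: measurableTypeR R]
    (fun x : measurableTypeR R => (x ^+ 2)%:E).
  by apply/measurable_EFinP; exact: exprn_measurable.
rewrite ge0_integral_normal_prob//; last by move=> x; rewrite lee_fin sqr_ge0.
apply: (@le_trans _ _
    (\int[mu]_x ((6 * s ^+ 2)%:E * (normal_pdf 0 (2 * s) x)%:E))%E); last first.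
  rewrite ge0_integralZl//; last 2 first.
  - by move=> x _; rewrite lee_fin normal_pdf_ge0.
  - by rewrite lee_fin mulr_ge0 ?sqr_ge0.
  by rewrite integral_normal_pdf mule1.
apply: ge0_le_integral => //.
- by move=> x _; rewrite -EFinM lee_fin mulr_ge0 ?sqr_ge0 ?normal_pdf_ge0.
- exact: emeasurable_funM.
- by apply: emeasurable_funM => //; exact: measurable_cst.
move=> x _; rewrite -!EFinM lee_fin !normal_pdfE// normal_peakM// /normal_fun !subr0.
set y := x ^+ 2 / s ^+ 2.
have s2 : 0 < s ^+ 2 by rewrite exprn_gt0.
have y0 : 0 <= y by rewrite divr_ge0 ?sqr_ge0// ltW.
have xE : x ^+ 2 = s ^+ 2 * y by rewrite mulrC divfK ?gt_eqF.
have -> : - x ^+ 2 / (s ^+ 2 *+ 2) = - (3 / 8 * y) + - (y / 8).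
  by rewrite /y; field.
have -> : - x ^+ 2 / ((2 * s) ^+ 2 *+ 2) = - (y / 8).
  by rewrite /y; field.
rewrite expRD xE; set E := expR (- (y / 8)).
have E0 : 0 < E by exact: expR_gt0.
have P0 := normal_peak_ge0 s.
have y3 : y * expR (- (3 / 8 * y)) <= 3.
  by rewrite expRN ler_pdivrMr ?expR_gt0//; have := expR_ge1Dx (3 / 8 * y); lra.
have : s ^+ 2 * normal_peak s * E * (y * expR (- (3 / 8 * y))) <=
    s ^+ 2 * normal_peak s * E * 3.
  by rewrite ler_wpM2l// !mulr_ge0// ltW.
lra.
Qed.

End normal_prob_integral.

Section prod_prob_theory.
Context {R : realType}.

Lemma prod_probS d (T : measurableType d) n (P : 'I_n.+1 -> probability T R)
    (A : set (n.+1.-tuple T)) :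
  prod_prob P A = (\int[P ord0]_x
    prod_prob (fun i => P (lift ord0 i)) [set t : n.-tuple T | A [tuple of x :: t]])%E.
Proof.
rewrite /= /distribution /pushforward /product_measure1; apply: eq_integral => x _ /=.
by congr (prod_prob _ _); apply/seteqP; split => t; rewrite /xsection /= inE.
Qed.

Lemma measurable_cons_section d (T : measurableType d) n x (A : set (n.+1.-tuple T)) :
  measurable A -> measurable [set t : n.-tuple T | A [tuple of x :: t]].
Proof.
move=> mA; rewrite -[X in measurable X]setTI.
exact: measurable_cons.
Qed.

Lemma measurable_prod_prob_cons_section d (T : measurableType d) n
    (Q : probability (n.-tuple T) R) (A : set (n.+1.-tuple T)) :
  measurable A ->
  measurable_fun [set: T] (fun x => Q [set t : n.-tuple T | A [tuple of x :: t]]).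
Proof.
move=> mA; pose B := @cons_pair _ T n @^-1` A.
have mB : measurable B by rewrite -[B]setTI; exact: measurable_cons_pair.
have := measurable_fun_xsection Q mB.
rewrite (_ : _ \o _ = fun x => Q [set t : n.-tuple T | A [tuple of x :: t]])//.
apply/funext => x /=; congr (Q _).
by apply/seteqP; split => t; rewrite /xsection /= inE.
Qed.

Lemma prod_prob_map d d' (T : measurableType d) (T' : measurableType d') n
    (P : 'I_n -> probability T R) (P' : 'I_n -> probability T' R)
    (f : 'I_n -> T -> T') :
  (forall i, measurable_fun [set: T] (f i)) ->
  (forall i A, measurable A -> P' i A = P i (f i @^-1` A)) ->
  forall A, measurable A -> prod_prob P' A =
    prod_prob P [set t : n.-tuple T | A [tuple f i (tnth t i) | i < n]].
Proof.
elim: n P P' f => [|n IHn] P P' f mf P'E A mA.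
  rewrite /= !diracE; congr (nat_of_bool _)%:R%:E.
  by apply/idP/idP; rewrite !inE /= [X in A X -> _]tuple0 [X in _ -> A X]tuple0.
rewrite !prod_probS.
transitivity (\int[pushforward (P ord0) (f ord0)]_x
    prod_prob (fun i => P' (lift ord0 i)) [set t : n.-tuple T' | A [tuple of x :: t]])%E.
  by apply: eq_measure_integral => B mB _; exact: P'E.
rewrite ge0_integral_pushforward//; last first.
  exact: measurable_prod_prob_cons_section.
apply: eq_integral => x _ /=.
rewrite (IHn (fun i => P (lift ord0 i)) _ (fun i => f (lift ord0 i)))//; last 2 first.
- by move=> i B mB; exact: P'E.
- exact: measurable_cons_section.
congr (prod_prob _ _); apply/seteqP; split => t /=; congr A; apply: eq_from_tnth => i;
  by case: (unliftP ord0 i) => [j|] ->; rewrite tnth_mktuple ?tnthS ?tnth0 ?tnth_mktuple.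
Qed.

Lemma prod_prob_tnth d (T : measurableType d) n (P : 'I_n -> probability T R) i A :
  measurable A -> prod_prob P [set t : n.-tuple T | A (tnth t i)] = P i A.
Proof.
elim: n P i => [|n IHn] P i mA; first by case: i.
rewrite prod_probS; case: (unliftP ord0 i) => [j|] ->.
  rewrite (eq_integral (cst (P (lift ord0 j) A))).
    by rewrite integral_cst//= probability_setT mule1.
  move=> x _ /=; rewrite -(IHn (fun i => P (lift ord0 i)) j mA); congr (prod_prob _ _).
  by apply/seteqP; split => t /=; rewrite tnthS.
rewrite (eq_integral (fun x => (\1_A x)%:E)).
  by rewrite integral_indic// setIT.
move=> x _; rewrite indicE; have [xA|xA] := boolP (x \in A).
  rewrite -[RHS](@probability_setT _ _ _ (prod_prob (fun i => P (lift ord0 i)))).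
  by congr (prod_prob _ _); apply/seteqP; split => t //= _; exact: set_mem.
rewrite -[RHS](@measure0 _ _ _ (prod_prob (fun i => P (lift ord0 i)))).
by congr (prod_prob _ _); apply/seteqP; split => t //=; rewrite tnth0 => /mem_set;
  exact/negP.
Qed.

Lemma ge0_integral_prod_prob_tnth d (T : measurableType d) n
    (P : 'I_n -> probability T R) i (f : T -> \bar R) :
  measurable_fun [set: T] f -> (forall x, 0 <= f x)%E ->
  (\int[prod_prob P]_t f (tnth t i) = \int[P i]_x f x)%E.
Proof.
move=> mf f0.
transitivity (\int[pushforward (prod_prob P) (fun t : n.-tuple T => tnth t i)]_x f x)%E.
  by rewrite ge0_integral_pushforward//; exact: measurable_tnth.
apply: eq_measure_integral => [|mt A mA _]; first exact: measurable_tnth.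
exact: (prod_prob_tnth P i mA).
Qed.

End prod_prob_theory.

Section integral_lower_bound.
Context d (T : measurableType d) (R : realType) (mu : {measure set T -> \bar R}).

(* The integral of a nonnegative function is a supremum over the simple
   functions below it, so the larger function need not be measurable. *)
Lemma ge0_le_integral_nonmeasurable (f g : T -> \bar R) :
  (forall x, 0 <= f x)%E -> (forall x, f x <= g x)%E ->
  (\int[mu]_x f x <= \int[mu]_x g x)%E.
Proof.
move=> f0 fg; have g0 x : (0 <= g x)%E by exact: le_trans (fg x).
rewrite !ge0_integralTE//; apply: le_ereal_sup => _ [h hf <-].
by exists h => // x; exact: le_trans (fg x).
Qed.

Lemma ge0_integral_EFinZl (k : R) (f : T -> R) : 0 <= k ->
  measurable_fun [set: T] f -> (forall x, 0 <= f x) ->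
  (\int[mu]_x (k * f x)%:E = k%:E * \int[mu]_x (f x)%:E)%E.
Proof.
move=> k0 mf f0; under eq_integral do rewrite EFinM.
apply: ge0_integralZl => //; first exact/measurable_EFinP.
by move=> x _; rewrite lee_fin.
Qed.

Lemma le_measure_integral (a : R) (A : set T) (f : T -> \bar R) :
  0 <= a -> measurable A -> (forall x, 0 <= f x)%E ->
  (forall x, A x -> a%:E <= f x)%E -> (a%:E * mu A <= \int[mu]_x f x)%E.
Proof.
move=> a0 mA f0 af.
have -> : (a%:E * mu A = \int[mu]_x (a * \1_A x)%:E)%E.
  rewrite ge0_integral_EFinZl//.
  by rewrite integral_indic// setIT.
apply: ge0_le_integral_nonmeasurable => x.
  by rewrite lee_fin mulr_ge0.
rewrite indicE; have [xA|_] := boolP (x \in A); last by rewrite mulr0.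
by rewrite mulr1; apply: af; exact: set_mem.
Qed.

End integral_lower_bound.

Section gaussian_noise.
Context {R : realType} {d : nat}.
Local Notation T := (d.-tuple (measurableTypeR R)).
Implicit Types (theta : 'rV[R]_d) (sigma p : R).

Lemma measurable_coord (i : 'I_d) :
  measurable_fun [set: T] (fun y => (rv_of_tuple y : 'rV[R]_d) ord0 i).
Proof.
rewrite (_ : (fun y => _) = (fun y : T => tnth y i)); last first.
  by apply/funext => y; rewrite mxE.
exact: measurable_tnth.
Qed.

Lemma measurable_set_le (f g : T -> R) : measurable_fun [set: T] f ->
  measurable_fun [set: T] g -> measurable [set y | f y <= g y].
Proof.
move=> mf mg.
have := measurable_fun_ler mf mg; move=> /(_ measurableT [set true] I).
by rewrite setTI; congr measurable; apply/seteqP; split => y.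
Qed.

Lemma measurable_dot_rv (v : 'rV[R]_d) :
  measurable_fun [set: T] (fun y => dot (rv_of_tuple y) v).
Proof.
apply: measurable_sum => i; apply: measurable_funM; last exact: measurable_cst.
exact: measurable_coord.
Qed.

Lemma measurable_typical_noise sigma (A : {set 'I_d}) :
  measurable [set y : T | typical_noise sigma A (rv_of_tuple y)].
Proof.
apply: measurableI; apply: measurable_set_le; try exact: measurable_cst.
- apply: measurable_sum => i; apply: measurableT_comp => //.
  exact: measurable_coord.
- rewrite (_ : (fun y => _) = fun y : T =>
    \sum_i (if i \in A then (rv_of_tuple y : 'rV[R]_d) ord0 i ^+ 2 else 0)).
    apply: measurable_sum => i; case: (i \in A); last exact: measurable_cst.
    by apply: measurable_funX; exact: measurable_coord.
  by apply/funext => y; rewrite [LHS]big_mkcond.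
Qed.

Lemma measurable_gap_event p (s : R) :
  measurable [set y : T | gap_event p s (rv_of_tuple y)].
Proof.
pose g (w v : 'rV[rat]_d) (y : T) : R :=
  dot (rv_of_tuple y) (rat_rv w) - sqnorm (rat_rv w : 'rV[R]_d) / 2 -
  (dot (rv_of_tuple y) (rat_rv v) - sqnorm (rat_rv v : 'rV[R]_d)).
have mg w v : measurable_fun [set: T] (g w v).
  by apply: measurable_funB; apply: measurable_funB;
    [exact: measurable_dot_rv|exact: measurable_cst|
     exact: measurable_dot_rv|exact: measurable_cst].
pose D : set 'rV[rat]_d := [set w | lp_ball p (rat_rv w : 'rV[R]_d)].
have mD w : measurable [set _ : T | D w].
  have [Dw|nDw] := pselect (D w).
    by rewrite (_ : [set _ | _] = setT)//; apply/seteqP; split.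
  by rewrite (_ : [set _ | _] = set0)//; apply/seteqP; split.
rewrite (_ : [set y | _] = \bigcup_w ([set _ | D w] `&`
    ~` \bigcup_v ([set _ | D v] `&` [set y | g w v y <= s / 2]))).
  apply: countable_bigcupT_measurable => [|w]; first exact: countableP.
  apply: measurableI; first exact: mD.
  apply: measurableC; apply: countable_bigcupT_measurable => [|v].
    exact: countableP.
  apply: measurableI; first exact: mD.
  by apply: measurable_set_le => //; exact: mg.
apply/seteqP; split => y.
- move=> [w Dw wP]; exists w => //; split; first exact: Dw.
  by move=> [v _ [Dv /=]]; apply/negP; rewrite -ltNge; exact: wP.
- move=> [w _ [Dw wP]]; exists w; first exact: Dw.
  move=> v Dv; rewrite ltNge; apply/negP => gs; apply: wP.
  by exists v.
Qed.

Lemma normal_vec_shift theta sigma (A : set T) : sigma != 0 -> measurable A ->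
  normal_vec theta sigma A = normal_vec (0 : 'rV[R]_d) sigma
    [set y : T | A [tuple tnth y i + theta ord0 i | i < d]].
Proof.
move=> s0 mA; pose f i (x : measurableTypeR R) : measurableTypeR R := x + theta ord0 i.
have mf i : measurable_fun [set: measurableTypeR R] (f i) by exact: measurable_funD.
apply: (prod_prob_map (f := f)
  (P := fun i => normal_prob ((0 : 'rV[R]_d) ord0 i) sigma) mf _ mA).
by move=> i B mB; rewrite mxE; exact: normal_prob_shift.
Qed.

Lemma expectation_ge_noise (theta : 'rV[R]_d) sigma (a : R) (E : set 'rV[R]_d)
    (f : 'rV[R]_d -> R) : sigma != 0 -> 0 <= a ->
  measurable [set y : T | E (rv_of_tuple y)] -> (forall y, 0 <= f y) ->
  (forall xi, E xi -> a <= f (theta + xi)) ->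
  (a%:E * normal_vec (0 : 'rV[R]_d) sigma [set y : T | E (rv_of_tuple y)] <=
   'E_(normal_vec theta sigma)[fun y : d.-tuple R => f (rv_of_tuple y)])%E.
Proof.
move=> s0 a0 mE f0 Ef.
pose A := [set y : T | E (rv_of_tuple y - theta)].
have mA : measurable A.
  pose g (y : T) : T := [tuple tnth y i - theta ord0 i | i < d].
  have mg : measurable_fun [set: T] g.
    apply/measurable_fun_tnthP => i.
    rewrite (_ : _ \o _ = (fun y : T => tnth y i - theta ord0 i)); last first.
      by apply/funext => y; rewrite /= tnth_mktuple.
    by apply: measurable_funB; [exact: measurable_tnth|exact: measurable_cst].
  have := mg measurableT _ mE; rewrite setTI; congr measurable.
  apply/seteqP; split => y; rewrite /A /=; congr E; apply/rowP => i;
    by rewrite !mxE tnth_mktuple.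
have -> : normal_vec (0 : 'rV[R]_d) sigma [set y : T | E (rv_of_tuple y)] =
    normal_vec theta sigma A.
  rewrite (normal_vec_shift theta s0 mA); congr (normal_vec _ _ _).
  apply/seteqP; split => y; rewrite /A /=; congr E; apply/rowP => i;
    by rewrite !mxE tnth_mktuple addrK.
rewrite unlock; apply: le_measure_integral => // [y|y]; rewrite lee_fin//.
by move=> /Ef; rewrite addrC subrK.
Qed.

Lemma typical_noise_prob sigma (A : {set 'I_d}) : 0 < sigma -> (0 < #|A|)%N ->
  ((2^-1)%:E <= normal_vec (0 : 'rV[R]_d) sigma
     [set y : T | typical_noise sigma A (rv_of_tuple y)])%E.
Proof.
move=> s0 A0; set P := normal_vec _ _; set G := [set y | _].
have mG : measurable G by exact: measurable_typical_noise.
have k0 : 0 < #|A|%:R :> R by rewrite ltr0n.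
have dA : (#|A| <= d)%N by rewrite -[leqRHS]card_ord; exact: max_card.
have d0 : 0 < d%:R :> R by rewrite ltr0n (leq_trans A0).
pose I : set (measurableTypeR R) := `[(- (8^-1 * sigma))%R, (8^-1 * sigma)%R]%classic.
have mI : measurable I by exact: measurable_itv.
pose b : R := (24 * sigma ^+ 2 * #|A|%:R)^-1.
have b0 : 0 < b by rewrite invr_gt0 !mulr_gt0// exprn_gt0.
pose u i (x : measurableTypeR R) : R :=
  2 / d%:R * \1_I x + (if i \in A then b * x ^+ 2 else 0).
have u0 i x : 0 <= u i x.
  apply: addr_ge0; first by rewrite mulr_ge0// divr_ge0// ltW.
  by case: (i \in A) => //; apply: mulr_ge0; [exact: ltW|exact: sqr_ge0].
have mI1 : measurable_fun [set: measurableTypeR R] (fun x => 2 / d%:R * \1_I x : R).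
  by apply: measurable_funM; [exact: measurable_cst|exact: measurable_indic].
have mA2 i : measurable_fun [set: measurableTypeR R]
    (fun x : measurableTypeR R => if i \in A then b * x ^+ 2 else 0 : R).
  case: (i \in A); last exact: measurable_cst.
  by apply: measurable_funM; [exact: measurable_cst|exact: exprn_measurable].
have mu_ i : measurable_fun [set: measurableTypeR R] (u i).
  exact: measurable_funD.
have Eu i : (\int[P]_y (u i (tnth y i))%:E <=
    (2 / d%:R * 8^-1 + (if i \in A then b * (6 * sigma ^+ 2) else 0))%:E)%E.
  rewrite (ge0_integral_prod_prob_tnth _ _ (f := fun x => (u i x)%:E)); last 2 first.
  - exact/measurable_EFinP.
  - by move=> x; rewrite lee_fin.
  rewrite mxE /u; under eq_integral do rewrite EFinD.
  rewrite ge0_integralD//; try exact/measurable_EFinP; last first.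
    move=> x _; case: (i \in A) => //.
    by rewrite lee_fin; apply: mulr_ge0; [exact: ltW|exact: sqr_ge0].
  rewrite EFinD leeD//.
    have d2 : 0 <= 2 / d%:R :> R by rewrite divr_ge0// ltW.
    rewrite ge0_integral_EFinZl// integral_indic// setIT [leRHS]EFinM.
    by apply: lee_wpmul2l; [rewrite lee_fin|exact: normal_prob_itv_le].
  case: (i \in A); last by rewrite integral0.
  rewrite ge0_integral_EFinZl ?(ltW b0)//; last by move=> x; exact: sqr_ge0.
  rewrite [leRHS]EFinM.
  by apply: lee_wpmul2l; [rewrite lee_fin ltW|exact: normal_prob_sqr_le].
have PGC : (P (~` G) <= (2^-1)%:E)%E.
  rewrite -[leLHS]mul1e.
  apply: (@le_trans _ _ (\int[P]_y (\sum_i u i (tnth y i))%:E)%E).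
    apply: le_measure_integral => //.
    - exact: measurableC.
    - by move=> y; rewrite lee_fin sumr_ge0.
    move=> y yG; rewrite lee_fin leNgt; apply/negP => U1; apply: yG.
    have S1 : 0 <= \sum_i 2 / d%:R * \1_I (tnth y i : measurableTypeR R) :> R.
      by apply: sumr_ge0 => i _; rewrite mulr_ge0 ?divr_ge0// ltW.
    have S2 : 0 <= \sum_i (if i \in A then b * tnth y i ^+ 2 else 0).
      apply: sumr_ge0 => i _; case: (i \in A) => //.
      by rewrite mulr_ge0 ?sqr_ge0// ltW.
    move: U1; rewrite /u big_split /= => U1; split.
    - have yi i : sigma / 8 * (1 - \1_I (tnth y i : measurableTypeR R)) <=
          `|(rv_of_tuple y : 'rV[R]_d) ord0 i|.
        rewrite mxE indicE; have [_|] := boolP (_ \in _).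
          by rewrite subrr mulr0.
        rewrite notin_setE /I /= in_itv /= => /negP; rewrite -ler_norml -ltNge.
        by rewrite subr0 mulr1 mulrC => /ltW.
      apply: le_trans (ler_sum _ (fun i _ => yi i)).
      rewrite -mulr_sumr sumrB sumr_const card_ord.
      move: U1 S1; rewrite -mulr_sumr; set N := \sum_i \1_I _ => U1 _.
      have Nd : N <= d%:R / 2.
        rewrite ler_pdivlMr// mulrC -[leRHS]mul1r -ler_pdivrMr// mulrAC.
        by apply: ltW; apply: le_lt_trans U1; rewrite lerDl.
      have : sigma / 8 * N <= sigma / 8 * (d%:R / 2).
        by rewrite ler_wpM2l// divr_ge0// ltW.
      lra.
    - have := le_lt_trans _ U1; move=> /(_ (\sum_(i in A) b * tnth y i ^+ 2)).
      rewrite [X in X <= _]big_mkcond /= lerDr => /(_ S1) => /ltW.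
      rewrite -mulr_sumr mulrC ler_pdivrMr ?invr_gt0// => [h|].
        rewrite (eq_bigr (fun i => tnth y i ^+ 2)) => [|i _]; last by rewrite mxE.
        by rewrite mul1r in h.
      by rewrite -invr_gt0.
  under eq_integral do rewrite -sumEFin.
  rewrite ge0_integral_sum//; last 2 first.
  - move=> i; apply/measurable_EFinP.
    by apply: (measurableT_comp (mu_ i)); exact: measurable_tnth.
  - by move=> i y _; rewrite lee_fin.
  apply: le_trans (lee_sum _ (fun i _ => Eu i)) _.
  rewrite sumEFin lee_fin big_split /= -big_mkcond !sumr_const card_ord.
  have -> : (2 / d%:R * 8^-1) *+ d = 4^-1 :> R.
    by rewrite -mulr_natr; field; rewrite gt_eqF.
  have -> : (b * (6 * sigma ^+ 2)) *+ #|A| = 4^-1 :> R.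
    by rewrite -mulr_natr /b; field; rewrite !gt_eqF.
  lra.
have -> : G = ~` ~` G by rewrite setCK.
rewrite probability_setC//; last exact: measurableC.
rewrite (_ : (2^-1)%:E = 1 - (2^-1)%:E)%E; first exact: leeB.
by rewrite -EFinB; congr EFin; field.
Qed.

End gaussian_noise.

(** * Lower bound on the risk *)

Lemma le_ereal_sup_three d (T : measurableType d) (R : realType)
    (P : probability T R) (G E0 E1 E2 : set T) (a : R) (M : \bar R) :
  0 <= a -> measurable G -> measurable E0 -> measurable E1 -> measurable E2 ->
  G `<=` E0 `|` E1 `|` E2 -> ((2^-1)%:E <= P G)%E ->
  (a%:E * P E0 <= M)%E -> (a%:E * P E1 <= M)%E -> (a%:E * P E2 <= M)%E ->
  ((a / 6)%:E <= M)%E.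
Proof.
move=> a0 mG m0 m1 m2 GE PG.
have : (P G <= P E0 + P E1 + P E2)%E.
  apply: (@le_trans _ _ (P (E0 `|` E1 `|` E2))).
    by apply: le_measure; rewrite ?inE//; apply: measurableU => //; exact: measurableU.
  apply: le_trans (measureU2 _ _ _) _ => //; first exact: measurableU.
  by rewrite leeD2r// measureU2.
have fP E : measurable E -> P E = (fine (P E))%:E.
  by move=> mE; rewrite fineK// fin_num_measure.
rewrite (fP _ m0) (fP _ m1) (fP _ m2).
move: (fine (P E0)) (fine (P E1)) (fine (P E2)) => x0 x1 x2 PE.
have {PG PE} : 2^-1 <= x0 + x1 + x2.
  by rewrite -lee_fin !EFinD; exact: le_trans PE.
move=> x012 M0 M1 M2.
have aM x : 6^-1 <= x -> (a%:E * x%:E <= M)%E -> ((a / 6)%:E <= M)%E.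
  by move=> x6; apply: le_trans; rewrite -EFinM lee_fin ler_wpM2l.
have [x0s|x0s] := leP 6^-1 x0; first exact: aM M0.
have [x1s|x1s] := leP 6^-1 x1; first exact: aM M1.
apply: aM M2; lra.
Qed.

Theorem proposition2 (R : realType) :
  exists2 c : R, 0 < c &
  forall (d : nat) (p q sigma : R),
    (4 <= d)%N ->
    1 + 1 / (ln d%:R + 1) < p < 2 ->
    q = p / (p - 1) ->
    1 / d%:R `^ (1 / p) <= sigma ->
    ((c * Num.min 1 (sigma * d%:R `^ (1 / q)))%:E <=
     ereal_sup
       [set 'E_(normal_vec theta sigma)[fun y : d.-tuple R =>
              (lp_norm 2 (eproj (lp_ball p) (rv_of_tuple y) - theta) ^+ 2)%R]
       | theta in @lp_ball R d p])%E.
Proof.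
exists ((128^-1) ^+ 4 / 4 / 6); first by rewrite !divr_gt0// exprn_gt0 ?invr_gt0.
move=> d p q sigma d4 /andP[p1' p2] -> sd'.
have d0 : (0 < d)%N by exact: leq_trans d4.
have dR : 0 < d%:R :> R by rewrite ltr0n.
have p1 : 1 < p.
  apply: le_lt_trans p1'; rewrite lerDl divr_ge0// addr_ge0// ln_ge0//.
  by rewrite ler1n.
have p0 : 0 < p by exact: lt_trans p1.
have -> : 1 / (p / (p - 1)) = 1 - p^-1.
  by field; rewrite subr_eq0 !gt_eqF.
have sd : d%:R `^ (- p^-1) <= sigma by rewrite powRN; move: sd'; rewrite !div1r.
have s0 : 0 < sigma by rewrite (lt_le_trans _ sd)// powR_gt0.
set s := Num.min _ _.
have sp : 0 <= s by rewrite le_min ler01 mulr_ge0 ?powR_ge0// ltW.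
have [A [h [A0 h0 Ah]]] := exists_hard_spike (ltW p1) (ltW p2) d0 sd (erefl s).
set M := ereal_sup _; set gam : R := (128^-1) ^+ 4 / 4.
have gs0 : 0 <= gam * s by rewrite mulr_ge0// divr_ge0// exprn_ge0// invr_ge0.
have gam1 : gam <= 1.
  rewrite ler_pdivrMr// mul1r (@le_trans _ _ 1) ?ler1n//.
  by rewrite exprn_ile1 ?invr_ge0// invf_le1 ?ler1n.
pose N : set 'rV[R]_d := typical_noise sigma A.
pose E0 : set 'rV[R]_d := N `&` gap_event p s.
pose E1 h' : set 'rV[R]_d :=
  N `&` (~` gap_event p s `&` [set xi | dot xi (spike A h') <= 0]).
pose ev (E : set 'rV[R]_d) := [set y : d.-tuple (measurableTypeR R) | E (rv_of_tuple y)].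
have mN : measurable (ev N) by exact: measurable_typical_noise.
have mgap : measurable (ev (gap_event p s)) by exact: measurable_gap_event.
have mE0 : measurable (ev E0) by exact: measurableI.
have mE1 h' : measurable (ev (E1 h')).
  apply: measurableI => //; apply: measurableI; first exact: measurableC.
  by apply: measurable_set_le => //; exact: measurable_dot_rv.
have risk theta E : lp_ball p theta -> measurable (ev E) ->
    (forall xi, E xi -> gam * s <= sqnorm (eproj (lp_ball p) (theta + xi) - theta)) ->
    ((gam * s)%:E * normal_vec (0 : 'rV[R]_d) sigma (ev E) <= M)%E.
  move=> Kth mE Eth; pose f y := lp_norm 2 (eproj (lp_ball p) y - theta) ^+ 2.
  have f0 y : 0 <= f y by exact: sqr_ge0.
  apply: le_trans (expectation_ge_noise (theta := theta) (f := f) _ gs0 mE f0 _) _.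
  - by rewrite gt_eqF.
  - by move=> xi /Eth; rewrite /f lp_norm2_sqr.
  - by apply: ereal_sup_ubound; exists theta.
rewrite mulrAC.
apply: (le_ereal_sup_three (P := normal_vec (0 : 'rV[R]_d) sigma) (G := ev N)
  (E0 := ev E0) (E1 := ev (E1 h)) (E2 := ev (E1 (- h)))) => //.
- move=> y Ny; have [g|ng] := pselect (gap_event p s (rv_of_tuple y)).
    by left; left; split.
  have [dh|dh] := leP (dot (rv_of_tuple y) (spike A h)) 0.
    by left; right; split => //; split.
  right; split => //; split => //=.
  rewrite (_ : spike A (- h) = (-1) *: spike A h).
    by rewrite dotZr mulN1r oppr_le0 ltW.
  by apply/rowP => i; rewrite !mxE; case: ifP; rewrite mulN1r ?oppr0.
- exact: typical_noise_prob.
- apply: (risk 0 E0); [by apply: lp_ball0; exact: ltW|exact: mE0|].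
  move=> xi [_ gxi]; rewrite add0r subr0.
  apply: le_trans (gap_event_sqnorm (ltW p1) gxi (eprojP (ltW p1) xi)).
  by rewrite ler_piMl.
- have [Kh riskh] := Ah h (gtr0_norm h0).
  apply: (risk (spike A h) (E1 h)); [exact: Kh|exact: mE1|].
  move=> xi [Nxi [ng dh]].
  by apply: (riskh xi _ Nxi ng dh); apply: eprojP; exact: ltW.
- have [|Kh riskh] := Ah (- h); first by rewrite normrN gtr0_norm.
  apply: (risk (spike A (- h)) (E1 (- h))); [exact: Kh|exact: mE1|].
  move=> xi [Nxi [ng dh]].
  by apply: (riskh xi _ Nxi ng dh); apply: eprojP; exact: ltW.
Qed.
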